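(* Let $q>3$ be an odd prime power and let $D$ be the standard derivation set on the line at infinity $\ell_\infty$ of $\mathrm{PG}(2,q^2)$. Suppose that $\ell_\infty$ is a secant of a hyperbola $K$ whose two infinite points are conjugate with respect to $D$ (so they lie outside $D$). Then either all points of $D$ are internal points of $K$, and $K$ (together with its two infinite points) is an oval in the projective Hall plane of order $q^2$ obtained from $D$; or all points of $D$ are external points of $K$, and there are two lines of the Hall plane containing $q+1$ points of $K$.
   Context: Use homogeneous coordinates $(X:Y:Z)$ in $\mathrm{PG}(2,q^2)$ with line at infinity $\ell_\infty: Z=0$, so $\mathrm{AG}(2,q^2)=\mathrm{PG}(2,q^2)\setminus\ell_\infty$. The standard derivation set is $D=\{(x:y:0)\mid x,y\in\mathrm{GF}(q),\ (x,y)\neq(0,0)\}\subset\ell_\infty$. The affine Hall plane $\mathrm{Hall}(q^2)$ has as points the points of $\mathrm{AG}(2,q^2)$; its lines are the ''old lines'', i.e. the affine parts of the lines of $\mathrm{PG}(2,q^2)$ other than $\ell_\infty$ whose infinite point is not in $D$, and the ''new lines'', i.e. the affine parts $B\setminus\ell_\infty$ of the Baer subplanes $B$ (subplanes of order $q$) of $\mathrm{PG}(2,q^2)$ containing $D$; explicitly, the new lines are the sets $\{(a+\lambda u,b+\lambda v): u,v\in\mathrm{GF}(q)\}$ with $a,b\in\mathrm{GF}(q^2)$, $\lambda\in\mathrm{GF}(q^2)^*$. The projective Hall plane is the projective closure of this affine plane; a point of $\ell_\infty\setminus D$ is identified with the infinite point of the parallel class of old lines through it. An oval in a projective plane of order $n$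 is a set of $n+1$ points no three of which are collinear. Conic means irreducible conic. A hyperbola is a conic of $\mathrm{PG}(2,q^2)$ having exactly two points on $\ell_\infty$ (its infinite points). Two points of $\ell_\infty\setminus D$ are conjugate with respect to $D$ if they are interchanged by $(x:y:0)\mapsto(x^q:y^q:0)$. A point not on $K$ is external if it lies on two tangents of $K$ and internal if it lies on no tangent of $K$. *)

(* Defs.v *)
From HB Require Import structures.
From mathcomp Require Import all_boot all_order all_algebra.
From mathcomp Require Import mpoly.

Set Implicit Arguments.
Unset Strict Implicit.
Unset Printing Implicit Defensive.

Import GRing.Theory.
Local Open Scope ring_scope.

Section Planes.

Variable T : finType.

Definition collinear (lines : {set {set T}}) (x y z : T) : bool :=
  [exists l in lines, [&& x \in l, y \in l & z \in l]].

Definition is_oval (points : {set T}) (lines : {set {set T}}) (n : nat)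
    (O : {set T}) : Prop :=
  [/\ O \subset points, #|O| = n.+1 &
      forall x y z, x \in O -> y \in O -> z \in O ->
        x != y -> y != z -> x != z -> ~~ collinear lines x y z].

(* Projective closure of the affine plane with the given points and lines:
   [inl x] is the affine point x, and [inr c] is the infinite point of the
   parallel class c. *)
Definition par_class (lines : {set {set T}}) (l : {set T}) : {set {set T}} :=
  [set m in lines | (m == l) || [disjoint m & l]].

Definition closure_infty (lines : {set {set T}}) : {set T + {set {set T}}} :=
  [set inr (par_class lines l) | l in lines].

Definition closure_points (points : {set T}) (lines : {set {set T}}) :
    {set T + {set {set T}}} :=
  [set inl x | x in points] :|: closure_infty lines.

Definition closure_line (lines : {set {set T}}) (l : {set T}) :
    {set T + {set {set T}}} :=
  inr (par_class lines l) |: [set inl x | x in l].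

Definition closure_lines (lines : {set {set T}}) :
    {set {set T + {set {set T}}}} :=
  closure_infty lines |: [set closure_line lines l | l in lines].

End Planes.

Definition irreducible_elt (A : idomainType) (a : A) : Prop :=
  [/\ a != 0, a \isn't a GRing.unit &
      forall b c, a = b * c -> b \is a GRing.unit \/ c \is a GRing.unit].

(* A point of PG(2, F) is a 1-dimensional subspace of F^3, encoded by the
   canonical square matrix <<A>> having it as row space. *)
Record pgpoint (F : finFieldType) : predArgType := PGPoint {
  pgmx : 'M[F]_3;
  _ : (<<pgmx>>%MS == pgmx) && (\rank pgmx == 1)%N
}.
HB.instance Definition _ (F : finFieldType) := [isSub for @pgmx F].
HB.instance Definition _ (F : finFieldType) := [Finite of pgpoint F by <:].

Section PG2.

Variable F : finFieldType.
Implicit Types (P R : pgpoint F) (K L : {set pgpoint F}) (x y z : F).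

Definition row3 x y z : 'rV[F]_3 := \row_(i < 3) [:: x; y; z]`_i.

(* P = (x : y : z) *)
Definition is_pt P x y z : bool :=
  (row3 x y z != 0) && (pgmx P == <<row3 x y z>>%MS).

Definition pgline (l : 'rV[F]_3) : {set pgpoint F} :=
  [set P | pgmx P *m l^T == 0].

Definition pglines : {set {set pgpoint F}} :=
  [set pgline l | l : 'rV[F]_3 & l != 0].

Definition linf : {set pgpoint F} := pgline (row3 0 0 1).

Definition affine_part L : {set pgpoint F} := L :\: linf.

Definition zero_set (Q : {mpoly F[3]}) : {set pgpoint F} :=
  [set P | [forall v : 'rV[F]_3, (v <= pgmx P)%MS ==> (Q.@[v 0] == 0)]].

Definition is_conic K : Prop :=
  exists Q : {mpoly F[3]},
    [/\ Q \is 2.-homog, irreducible_elt Q & K = zero_set Q].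

Definition is_hyperbola K : Prop := is_conic K /\ #|K :&: linf| = 2%N.

Definition tangents K : {set {set pgpoint F}} :=
  [set L in pglines | #|L :&: K| == 1%N].

Definition external_pt K P : bool :=
  (P \notin K) && (#|[set L in tangents K | P \in L]| == 2)%N.

Definition internal_pt K P : bool :=
  (P \notin K) && (#|[set L in tangents K | P \in L]| == 0)%N.

Section Hall.

Variable q : nat.

(* The subfield of order q, when #|F| = q ^ 2. *)
Definition GFq : {set F} := [set x | x ^+ q == x].

Definition derset : {set pgpoint F} :=
  [set P | [exists x in GFq, exists y in GFq, is_pt P x y 0]].

Definition conj_image P R : bool :=
  [exists x, exists y, is_pt P x y 0 && is_pt R (x ^+ q) (y ^+ q) 0].

Definition conjugate_pts P R : bool :=
  [&& P \in linf :\: derset, R \in linf :\: derset,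
      conj_image P R & conj_image R P].

Definition old_lines : {set {set pgpoint F}} :=
  [set affine_part L | L in pglines & (L != linf) && [disjoint L & derset]].

(* The affine parts of the Baer subplanes containing [derset], in explicit
   coordinates: translates of the multiples by l of the subplane AG(2, q). *)
Definition new_line (a b l : F) : {set pgpoint F} :=
  [set P | [exists u in GFq, exists v in GFq,
              is_pt P (a + l * u) (b + l * v) 1]].

Definition new_lines : {set {set pgpoint F}} :=
  [set N | [exists a, exists b, exists l,
              (l != 0) && (N == new_line a b l)]].

Definition hall_affine_lines : {set {set pgpoint F}} := old_lines :|: new_lines.

Definition hall_type : finType := (pgpoint F + {set {set pgpoint F}})%type.

Definition hall_points : {set hall_type} :=
  closure_points (~: linf) hall_affine_lines.

Definition hall_lines : {set {set hall_type}} :=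
  closure_lines hall_affine_lines.

Definition old_class P : {set {set pgpoint F}} :=
  [set affine_part L | L in pglines & (L != linf) && (P \in L)].

(* The point of the projective Hall plane identified with P; meaningful only
   for P outside [derset]. *)
Definition hall_pt P : hall_type :=
  if P \in linf then inr (old_class P) else inl P.

Definition hall_set K : {set hall_type} := [set hall_pt P | P in K].

End Hall.

End PG2.

Arguments linf : clear implicits.
Arguments pglines : clear implicits.
Arguments derset F q : clear implicits.
Arguments hall_points F q : clear implicits.
Arguments hall_lines F q : clear implicits.

(* Main.v *)
Require Import Defs.
From mathcomp Require Import all_boot all_order all_algebra all_field.
From mathcomp Require Import mpoly ring zify.

Set Implicit Arguments.
Unset Strict Implicit.
Unset Printing Implicit Defensive.

Import GRing.Theory.
Local Open Scope ring_scope.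

(** Write a' for the conjugate a ^+ q, and let P1 = (x : y : 0) and
    P2 = (x' : y' : 0) be the infinite points of K. As P1 is not in the
    derivation set, D = x * y' - x' * y is nonzero, so the two linear forms
    y * X - x * Y and y' * X - x' * Y are coordinates of the affine plane. They
    vanish at P1 and P2 respectively, and after a translation (to the centre of
    K) they give coordinates s, t in which the affine part of K is s * t = e.
    Irreducibility of the conic means e != 0 ([hyperbola_equation]). On GF(q)
    points the two forms are conjugate, so the points of the derivation set are
    the directions (w, w') with w != 0, and the new lines are the sets
    {(A + l * w, B + l * w')}, where w runs over the whole field.

    The dichotomy is whether e is a square. A line of direction (w, w') has an
    equation w' * s - w * t + g = 0 and is tangent to K exactly when
    g ^+ 2 = - 4 * e * w ^+ q.+1. Now w ^+ q.+1 is a square because q is odd,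
    and -1 is a square because D' = - D. So there are two tangents when e is a
    square and none otherwise, for every point of the derivation set
    ([card_derset_tangents]).

    Old lines meet K in at most two points, as lines of PG(2, q ^ 2). A new line
    is {t = r * s' + g} with r = l / l', and it meets K where
    r * s ^+ q.+1 + g * s = e. If g != 0, the solution s is determined by its
    norm n = s ^+ q.+1, and taking norms in g * s = e - r * n gives a quadratic
    equation for n: at most two points ([card_new_line]). If g = 0, the equation
    is r * s ^+ q.+1 = e; it is solvable only if e is a square, since r and the
    norm are squares. Hence K is an oval when e is not a square. If e = c ^+ 2,
    conjugation gives r ^+ 2 = (c / c') ^+ 2, so r = c / c' or r = - (c / c'),
    and each of these two new lines has q + 1 points on K, the fibre of the norm
    map above an element of GF(q) ([two_secants_of_square]). *)

(** * Roots of quadratic polynomials *)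

Section Roots.
Variable F : finFieldType.
Implicit Types (a b c d r : F).

Lemma card_roots_quad a b c : ~~ [&& a == 0, b == 0 & c == 0] ->
  (#|[set r | (a * r ^+ 2 + b * r + c == 0)%R]| <= (if a == 0%R then 1 else 2))%N.
Proof.
move=> nz; pose p := Poly [:: c; b; a].
have pE r : p.[r] = a * r ^+ 2 + b * r + c.
  by rewrite horner_Poly /=; ring.
have coefp i : p`_i = [:: c; b; a]`_i by rewrite coef_Poly.
have p0 : p != 0.
  apply: contraNneq nz => p0; move: (coefp 0) (coefp 1) (coefp 2).
  by rewrite p0 !coef0 /= => <- <- <-; rewrite eqxx.
have szp : (size p <= (if a == 0%R then 2 else 3))%N.
  apply/leq_sizeP => j; rewrite coefp; case: eqP => [->|_].
    by case: j => [|[|[|[|]]]].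
  by case: j => [|[|[|[|]]]].
rewrite cardE; set s := enum _.
have : (size s < size p)%N.
  apply: max_poly_roots => //; last exact: enum_uniq.
  by apply/allP => r; rewrite mem_enum inE -pE.
by move=> /leq_trans/(_ szp); case: ifP.
Qed.

Hypothesis two_neq0 : 2 != 0 :> F.

Lemma card_sqrt d : #|[set r | r ^+ 2 == d]| =
  if d == 0 then 1%N else if [exists r, r ^+ 2 == d] then 2%N else 0%N.
Proof.
case: eqP => [->|/eqP d0].
  rewrite (_ : [set r | _] = [set 0]) ?cards1 //.
  by apply/setP => r; rewrite !inE expf_eq0.
case: existsP => [[s /eqP sd]|nex]; last first.
  apply: eq_card0 => r; rewrite inE; apply/negP => rd.
  by apply: nex; exists r.
rewrite (_ : [set r | _] = [set s; - s]).
  rewrite cards2 -addr_eq0 -mulr2n -mulr_natl mulf_eq0 (negPf two_neq0) /=.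
  by move: d0; rewrite -sd expf_eq0 /= => ->.
by apply/setP => r; rewrite !inE -sd eqf_sqr.
Qed.

(** Substitutions r := a * r + b change neither the number of roots of a
    quadratic nor the number of lines in a pencil with a given property. *)
Lemma card_affine_image a b (A : pred F) : a != 0 ->
  #|[set r | A (a * r + b)]| = #|[set u | A u]|.
Proof.
move=> a0; rewrite -(card_imset [set r | A (a * r + b)] (f := fun r => a * r + b)).
  apply: eq_card => u; apply/imsetP/idP => [[r]|]; first by rewrite !inE => ? ->.
  rewrite inE => Au; exists ((u - b) / a); last by field.
  by rewrite inE (_ : a * _ + b = u) //; field.
by move=> r s /= /addIr /(mulfI a0).
Qed.

(** Completing the square turns the roots into square roots of the discriminant. *)
Lemma card_quad_eq1 a b c : a != 0 ->
  (#|[set r | a * r ^+ 2 + b * r + c == 0]| == 1%N) = (b ^+ 2 == 4 * a * c).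
Proof.
move=> a0; pose d := b ^+ 2 - 4 * a * c.
have -> : [set r | a * r ^+ 2 + b * r + c == 0]
        = [set r | (2 * a * r + b) ^+ 2 == d].
  apply/setP => r; rewrite !inE -subr_eq0 -[RHS]subr_eq0.
  rewrite (_ : (2 * a * r + b) ^+ 2 - d = 2 * 2 * a * (a * r ^+ 2 + b * r + c)).
    by rewrite [RHS]mulf_eq0 !mulf_eq0 (negPf a0) (negPf two_neq0) /= !subr0.
  by rewrite /d; ring.
rewrite (card_affine_image b (fun u => u ^+ 2 == d)) ?mulf_neq0 //.
rewrite card_sqrt -[in RHS]subr_eq0 -/d; case: (eqVneq d 0) => // _.
by case: ifP.
Qed.

End Roots.

(** * Ternary quadratic forms *)

Section QuadraticForms.
Variable F : finFieldType.

Lemma homog2_sum (n : nat) (Q : {mpoly F[n]}) : Q \is 2.-homog ->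
  exists A : 'M[F]_n, Q = \sum_i \sum_j A i j *: ('X_i * 'X_j).
Proof.
have mono (m : 'X_{1..n}) : mdeg m = 2 -> exists i j, m = (U_(i) + U_(j))%MM.
  move=> dm; have /existsP [i mi] : [exists i, (0 < m i)%N].
    apply: contraT; rewrite negb_exists => /forallP m0.
    have : mdeg m = 0%N.
      by rewrite mdegE big1 // => i _; apply/eqP; rewrite -leqn0 leqNgt.
    by rewrite dm.
  have Um : (U_(i) <= m)%MM.
    by apply/mnm_lepP => j; rewrite mnm1E; case: eqP => // <-.
  have /mdeg1P [j /eqP jE] : mdeg (m - U_(i))%MM == 1%N.
    by move: dm; rewrite -{1}(submK Um) mdegD mdeg1 addn1 => -[->].
  by exists i, j; rewrite -jE addmC submK.
move=> /dhomogP hQ; rewrite [Q]mpolyE big_seq.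
apply: (big_ind (fun P : {mpoly F[n]} =>
  exists A : 'M[F]_n, P = \sum_i \sum_j A i j *: ('X_i * 'X_j))).
- exists 0; rewrite big1 // => i _; rewrite big1 // => j _.
  by rewrite mxE scale0r.
- move=> _ _ [A ->] [B ->]; exists (A + B).
  rewrite -big_split; apply: eq_bigr => i _; rewrite -big_split.
  by apply: eq_bigr => j _; rewrite mxE scalerDl.
move=> m /hQ /mono[i [j ->]]; set c := Q@_ _.
exists (c *: delta_mx i j).
rewrite (bigD1 i) //= [X in _ = _ + X]big1 => [|k /negPf ki]; last first.
  by rewrite big1 // => l _; rewrite !mxE ki /= mulr0 scale0r.
rewrite (bigD1 j) //= [X in _ = _ + X + _]big1 => [|k /negPf kj]; last first.
  by rewrite !mxE kj andbF mulr0 scale0r.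
by rewrite !addr0 !mxE !eqxx mulr1 mpolyXD.
Qed.

Let X0 : {mpoly F[3]} := 'X_ord0.
Let X1 : {mpoly F[3]} := 'X_(lift ord0 ord0).
Let X2 : {mpoly F[3]} := 'X_(lift ord0 (lift ord0 ord0)).

Definition quad_poly (a b c d e f : F) : {mpoly F[3]} :=
  a%:MP * X0 ^+ 2 + b%:MP * X0 * X1 + c%:MP * X1 ^+ 2
  + d%:MP * X0 * X2 + e%:MP * X1 * X2 + f%:MP * X2 ^+ 2.

Definition quad_form (a b c d e f x y z : F) : F :=
  a * x ^+ 2 + b * x * y + c * y ^+ 2 + d * x * z + e * y * z + f * z ^+ 2.

Lemma homog2_quad_poly (Q : {mpoly F[3]}) : Q \is 2.-homog ->
  exists a b c d e f, Q = quad_poly a b c d e f.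
Proof.
move=> /homog2_sum[A ->].
pose i0 : 'I_3 := ord0; pose i1 : 'I_3 := lift ord0 ord0.
pose i2 : 'I_3 := lift ord0 (lift ord0 ord0).
exists (A i0 i0), (A i0 i1 + A i1 i0), (A i1 i1), (A i0 i2 + A i2 i0),
  (A i1 i2 + A i2 i1), (A i2 i2).
rewrite !big_ord_recl !big_ord0 -!mul_mpolyC /quad_poly !mpolyCD /X0 /X1 /X2.
by rewrite -[lift ord0 (lift ord0 ord0)]/i2 -[lift ord0 ord0]/i1 -[ord0]/i0; ring.
Qed.

Lemma quad_polyE a b c d e f x y z :
  (quad_poly a b c d e f).@[row3 x y z 0] = quad_form a b c d e f x y z.
Proof.
by rewrite /quad_form !expr2 !(mevalD, mevalM, mevalC, mevalXU) !mxE.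
Qed.

(** The coefficients of a quadratic form over any field can be read off from its
    values at six points, so a splitting of the values is a splitting of the
    polynomial. Linear forms vanish at the origin, hence are not units. *)
Lemma irreducible_quad_nosplit (Q : {mpoly F[3]}) a1 b1 c1 a2 b2 c2 :
  Q \is 2.-homog -> irreducible_elt Q ->
  ~ (forall x y z, Q.@[row3 x y z 0]
       = (a1 * x + b1 * y + c1 * z) * (a2 * x + b2 * y + c2 * z)).
Proof.
move=> /homog2_quad_poly[a [b [c [d [e [f ->]]]]]] [_ _ irrQ] E.
pose L (a b c : F) := a%:MP * X0 + b%:MP * X1 + c%:MP * X2.
have QL : quad_poly a b c d e f = L a1 b1 c1 * L a2 b2 c2.
  have := E 1 0 0; have := E 0 1 0; have := E 0 0 1.
  have := E 1 1 0; have := E 1 0 1; have := E 0 1 1.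
  rewrite !quad_polyE /quad_form.
  rewrite !(mulr0, mul0r, expr0n, expr1n, mulr1, addr0, add0r) /= => E6 E5 E4 E3 E2 E1.
  move: E4 E5 E6; rewrite E1 E2 E3.
  move=> /(canRL (addrK _)) /(canRL (addKr _)) ->.
  move=> /(canRL (addrK _)) /(canRL (addKr _)) ->.
  move=> /(canRL (addrK _)) /(canRL (addKr _)) ->.
  by rewrite /quad_poly /L; ring.
have L_nonunit u v w : L u v w \isn't a GRing.unit.
  apply/negP => uL; have : (L u v w * (L u v w)^-1).@[row3 0 0 0 0] = 1.
    by rewrite mulrV // rmorph1.
  rewrite mevalM !(mevalD, mevalM, mevalC, mevalXU) !mxE /= !mulr0 !addr0 mul0r.
  by move=> /eqP; rewrite eq_sym oner_eq0.
by case: (irrQ _ _ QL); apply/negP.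
Qed.

End QuadraticForms.

(** * Points and lines in homogeneous coordinates *)

Section Points.
Variable F : finFieldType.
Implicit Types (P R : pgpoint F) (L M : {set pgpoint F}) (x y z a b c u v : F).

Lemma row3_scale k x y z : k *: row3 x y z = row3 (k * x) (k * y) (k * z).
Proof.
apply/rowP => i; rewrite !mxE.
by case: i => [[|[|[|]]]] //= _; rewrite mulr0.
Qed.

Lemma row3_inj x y z x' y' z' :
  row3 x y z = row3 x' y' z' -> [/\ x = x', y = y' & z = z'].
Proof.
move=> E; have e (i : 'I_3) := congr1 (fun w : 'rV_3 => w 0 i) E.
by split; [have := e (@Ordinal 3 0 isT) | have := e (@Ordinal 3 1 isT)
  | have := e (@Ordinal 3 2 isT)]; rewrite !mxE.
Qed.

Lemma row3_eq0 x y z : (row3 x y z == 0) = [&& x == 0, y == 0 & z == 0].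
Proof.
have -> : 0 = row3 0 0 0 :> 'rV[F]_3.
  by rewrite -(scale0r (row3 0 0 0)) row3_scale !mulr0.
by apply/eqP/and3P => [/row3_inj[-> -> ->]|[/eqP-> /eqP-> /eqP->]].
Qed.

Lemma row3_surj (w : 'rV[F]_3) : exists x y z, w = row3 x y z.
Proof.
exists (w 0 (@Ordinal 3 0 isT)), (w 0 (@Ordinal 3 1 isT)), (w 0 (@Ordinal 3 2 isT)).
apply/rowP => i; rewrite !mxE.
by case: i => [[|[|[|]]]] //= h; congr (w 0 _); apply: val_inj.
Qed.

(** Replacing the zero vector by (0, 0, 1) makes (x : y : z) total in its
    coordinates. *)
Let gen x y z := if row3 x y z == 0 then row3 0 0 1 else row3 x y z.

Fact pgpt_subproof x y z :
  (<<<<gen x y z>>>>%MS == <<gen x y z>>%MS) && (\rank <<gen x y z>>%MS == 1)%N.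
Proof.
rewrite genmx_id eqxx mxrank_gen rank_rV /gen.
by case: ifPn => [_|-> //]; rewrite row3_eq0 oner_eq0 !andbF.
Qed.

Definition pgpt x y z : pgpoint F := PGPoint (pgpt_subproof x y z).

Lemma pgmx_pgpt x y z : row3 x y z != 0 -> pgmx (pgpt x y z) = <<row3 x y z>>%MS.
Proof. by rewrite /pgpt /= /gen => /negPf ->. Qed.

Lemma is_ptE P x y z : is_pt P x y z = (row3 x y z != 0) && (P == pgpt x y z).
Proof.
rewrite /is_pt; case: (boolP (row3 x y z != 0)) => //= nz.
by rewrite -pgmx_pgpt.
Qed.

Lemma pgptP P : exists x y z, row3 x y z != 0 /\ P = pgpt x y z.
Proof.
case/andP: (valP P) => /eqP g /eqP r.
have P0 : pgmx P != 0 by rewrite -mxrank_eq0 r.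
have [x [y [z E]]] := row3_surj (nz_row (pgmx P)).
have nz : row3 x y z != 0 by rewrite -E nz_row_eq0.
exists x, y, z; split => //; apply/val_inj.
change (pgmx P = pgmx (pgpt x y z)); rewrite pgmx_pgpt // -{1}g -E.
apply/esym/genmxP; rewrite -(mxrank_leqif_eq (nz_row_sub _)).
by rewrite rank_rV E nz r.
Qed.

Lemma pgpt_scale k x y z : k != 0 -> pgpt (k * x) (k * y) (k * z) = pgpt x y z.
Proof.
move=> k0; apply/val_inj; rewrite /= /gen -row3_scale scalemx_eq0 (negPf k0) /=.
by case: ifP => // _; apply/eq_genmx/eqmx_scale.
Qed.

Lemma pgpt_eq x y z x' y' z' : row3 x y z != 0 -> row3 x' y' z' != 0 ->
  pgpt x y z = pgpt x' y' z' -> exists k, [/\ x = k * x', y = k * y' & z = k * z'].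
Proof.
move=> nz nz' /(congr1 (@pgmx F)); rewrite !pgmx_pgpt // => /genmxP/andP[/sub_rVP[k E] _].
by exists k; move: E; rewrite row3_scale => /row3_inj.
Qed.

Lemma pgpt_line x y z a b c : row3 x y z != 0 ->
  (pgpt x y z \in pgline (row3 a b c)) = (a * x + b * y + c * z == 0).
Proof.
move=> nz; rewrite inE pgmx_pgpt //.
have -> : (<<row3 x y z>>%MS *m (row3 a b c)^T == 0) = (row3 x y z *m (row3 a b c)^T == 0).
  by apply/eqP/eqP => /sub_kermxP h; apply/sub_kermxP; move: h; rewrite genmxE.
have -> : row3 x y z *m (row3 a b c)^T = (a * x + b * y + c * z)%:M.
  apply/matrixP => i j; rewrite !ord1 !mxE !big_ord_recl big_ord0 !mxE /= addr0 addrA.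
  by rewrite [x * _]mulrC [y * _]mulrC [z * _]mulrC mulr1n.
by rewrite -scalemx1 scalemx_eq0 [1%:M == 0]oner_eq0 orbF.
Qed.

Lemma pgpt_zero_set (Q : {mpoly F[3]}) x y z : Q \is 2.-homog -> row3 x y z != 0 ->
  (pgpt x y z \in zero_set Q) = (Q.@[row3 x y z 0] == 0).
Proof.
move=> hQ nz; rewrite inE pgmx_pgpt //.
have [a [b [c [d [e [f QE]]]]]] := homog2_quad_poly hQ.
have E := quad_polyE a b c d e f; rewrite -QE in E.
apply/forallP/idP => [/(_ (row3 x y z))|Q0 v].
  by rewrite genmxE submx_refl.
apply/implyP; rewrite genmxE => /sub_rVP[k ->].
rewrite row3_scale E (_ : quad_form _ _ _ _ _ _ _ _ _ = k ^+ 2 * quad_form a b c d e f x y z).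
  by rewrite -E (eqP Q0) mulr0.
by rewrite /quad_form; ring.
Qed.

Lemma linfE x y z : row3 x y z != 0 -> (pgpt x y z \in linf F) = (z == 0).
Proof. by move=> nz; rewrite pgpt_line // !mul0r !add0r mul1r. Qed.

Lemma row3_aff x y : row3 x y 1 != 0.
Proof. by rewrite row3_eq0 oner_eq0 !andbF. Qed.
Hint Resolve row3_aff : core.

Lemma row3_inf x y : (row3 x y 0 != 0) = ((x, y) != (0, 0)).
Proof. by rewrite row3_eq0 eqxx andbT. Qed.

Lemma aff_notin_linf x y : pgpt x y 1 \notin linf F.
Proof. by rewrite linfE // oner_eq0. Qed.

Lemma affP P : P \notin linf F -> exists x y, P = pgpt x y 1.
Proof.
have [x [y [z [nz ->]]]] := pgptP P; rewrite linfE // => z0.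
by exists (x / z), (y / z); rewrite -[RHS](pgpt_scale _ _ _ z0) !(mulrC z) !divfK // mul1r.
Qed.

Lemma infP P : P \in linf F -> exists x y, (x, y) != (0, 0) /\ P = pgpt x y 0.
Proof.
have [x [y [z [nz ->]]]] := pgptP P; rewrite linfE // => /eqP z0.
by exists x, y; rewrite -row3_inf -z0.
Qed.

Lemma aff_inj x y x' y' : pgpt x y 1 = pgpt x' y' 1 -> x = x' /\ y = y'.
Proof.
by move=> /pgpt_eq[] // k [-> ->]; rewrite mulr1 => <-; rewrite !mul1r.
Qed.

(** The pencil of (u : v : 0), without the line at infinity: the free coefficient
    c serves to count lines through a point at infinity. *)
Definition dline u v c := pgline (row3 v (- u) c).

Lemma aff_dline u v c x y : (pgpt x y 1 \in dline u v c) = (v * x - u * y + c == 0).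
Proof. by rewrite pgpt_line // mulr1 mulNr. Qed.

Lemma inf_dline u v c : (u, v) != (0, 0) -> pgpt u v 0 \in dline u v c.
Proof. by move=> nz; rewrite pgpt_line ?row3_inf // mulr0 addr0 mulNr mulrC subrr. Qed.

Lemma dline_line u v c : (u, v) != (0, 0) -> dline u v c \in pglines F.
Proof.
move=> nz; apply: imset_f; rewrite inE row3_eq0 oppr_eq0.
by apply: contraNN nz; case/and3P => /eqP-> /eqP-> _.
Qed.

Lemma dline_neq_linf u v c : (u, v) != (0, 0) -> dline u v c != linf F.
Proof.
move=> nz; apply/eqP => E.
have h x y : (v * x - u * y + c == 0) = false.
  by rewrite -aff_dline E (negPf (aff_notin_linf x y)).
have /eqP c0 := h 0 0; move: nz; case: eqP => //.
have [v0|v0 _ _] := eqVneq v 0; last by have /eqP[] := h (- c / v) 0; field.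
move=> /eqP; rewrite v0 xpair_eqE eqxx andbT => u0 _.
by have /eqP[] := h 0 (c / u); rewrite v0; field.
Qed.

Lemma pgline_scale k (l : 'rV[F]_3) : k != 0 -> pgline (k *: l) = pgline l.
Proof.
move=> k0; apply/setP => P; rewrite !inE linearZ /= -scalemxAr scalemx_eq0.
by rewrite (negPf k0).
Qed.

(** A line through (u : v : 0) has its first two coefficients proportional to
    (v, - u), and they are not both zero off the line at infinity. *)
Lemma dlineP L u v : L \in pglines F -> L != linf F -> (u, v) != (0, 0) ->
  pgpt u v 0 \in L -> exists c, L = dline u v c.
Proof.
case/imsetP => l; have [a [b [c ->]]] := row3_surj l.
rewrite inE row3_eq0 => l0 -> Linf nz; rewrite pgpt_line ?row3_inf // mulr0 addr0 => /eqP E.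
have main k : k != 0 -> a = k * v -> b = - k * u -> exists c', pgline (row3 a b c) = dline u v c'.
  move=> k0 -> ->; exists (c / k); rewrite /dline -[RHS](@pgline_scale k) //.
  by rewrite row3_scale mulrN mulNr mulrC [k * (c / k)]mulrC divfK // [v * k]mulrC.
have ab0 : (a != 0) || (b != 0).
  rewrite -negb_and; apply/negP => /andP[/eqP a0 /eqP b0].
  move: l0 Linf; rewrite a0 b0 eqxx /= => c0.
  have -> : row3 0 0 c = c *: row3 0 0 1 by rewrite row3_scale !mulr0 mulr1.
  by rewrite pgline_scale // eqxx.
have [u0|u0] := eqVneq u 0.
  have v0 : v != 0 by apply: contraNneq nz => ->; rewrite u0.
  have b0 : b = 0 by move/eqP: E; rewrite u0 mulr0 add0r mulf_eq0 (negPf v0) orbF => /eqP.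
  apply: (main (a / v)); rewrite ?divfK // ?b0 ?u0 ?mulr0 //.
  by move: ab0; rewrite b0 eqxx orbF => a0; rewrite mulf_neq0 ?invr_neq0.
have aE : a = - (b / u) * v.
  by rewrite -[a](mulfK u0) -[a * u]opprK (addr0_eq E); field.
have b0 : b != 0 by apply: contraTneq ab0 => b0; rewrite aE b0 mul0r oppr0 mul0r eqxx.
apply: (main (- (b / u))) => //; last by field.
by rewrite oppr_eq0 mulf_neq0 ?invr_neq0.
Qed.

Lemma line_dline L : L \in pglines F -> L != linf F ->
  exists u v c, (u, v) != (0, 0) /\ L = dline u v c.
Proof.
move=> Ll Linf; case/imsetP: (Ll) => l.
have [a [b [c ->]]] := row3_surj l.
rewrite inE row3_eq0 => l0 E.
have nz : (b, - a) != (0, 0).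
  apply: contraNneq Linf => -[b0 /eqP]; rewrite oppr_eq0 => /eqP a0.
  move: l0 E; rewrite a0 b0 eqxx /= => c0 ->.
  have -> : row3 0 0 c = c *: row3 0 0 1 by rewrite row3_scale !mulr0 mulr1.
  by rewrite pgline_scale.
have [|c' Ec] := @dlineP L b (- a) Ll Linf nz.
  by rewrite E pgpt_line ?row3_inf // mulr0 addr0 mulrN mulrC subrr.
by exists b, (- a), c'.
Qed.

Lemma dline_inf P u v c : (u, v) != (0, 0) ->
  P \in linf F -> P \in dline u v c -> P = pgpt u v 0.
Proof.
move=> nz /infP[x [y [nz' ->]]]; rewrite pgpt_line ?row3_inf // mulr0 addr0 mulNr => /eqP E.
have [u0|u0] := eqVneq u 0.
  have v0 : v != 0 by apply: contraNneq nz => ->; rewrite u0.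
  have x0 : x = 0.
    by move/eqP: E; rewrite u0 mul0r subr0 mulf_eq0 (negPf v0) => /eqP.
  have y0 : y != 0 by apply: contraNneq nz' => ->; rewrite x0.
  rewrite -(@pgpt_scale (y / v) u v 0) ?mulf_neq0 ?invr_neq0 //.
  by rewrite u0 x0 !mulr0 divfK.
have yE : y = x / u * v.
  by rewrite -[y](mulKf u0) -(subr0_eq E); field.
have x0 : x != 0 by apply: contraNneq nz' => x0; rewrite yE x0 !mul0r.
rewrite -(@pgpt_scale (x / u) u v 0) ?mulf_neq0 ?invr_neq0 //.
by rewrite -yE mulr0 divfK.
Qed.

Lemma dline_aff u v c : (u, v) != (0, 0) -> exists x y, pgpt x y 1 \in dline u v c.
Proof.
move=> nz; have [v0|v0] := eqVneq v 0; last first.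
  by exists (- c / v), 0; rewrite aff_dline; apply/eqP; field.
have u0 : u != 0 by apply: contraNneq nz => ->; rewrite v0.
by exists 0, (c / u); rewrite aff_dline v0; apply/eqP; field.
Qed.

Lemma dline_meet u v c u' v' c' : u * v' != u' * v ->
  exists x y, pgpt x y 1 \in dline u v c /\ pgpt x y 1 \in dline u' v' c'.
Proof.
rewrite -subr_eq0 => d0; set d := _ - _ in d0.
exists ((c * u' - u * c') / d), ((c * v' - c' * v) / d).
by rewrite !aff_dline; split; apply/eqP; rewrite /d; field.
Qed.

Lemma dline_eq u v c c' x y :
  pgpt x y 1 \in dline u v c -> pgpt x y 1 \in dline u v c' -> c = c'.
Proof.
rewrite !aff_dline => /eqP E1 /eqP E2.
by apply: (addrI (v * x - u * y)); rewrite E1 E2.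
Qed.

Lemma in_affine_part x y L : (pgpt x y 1 \in affine_part L) = (pgpt x y 1 \in L).
Proof. by rewrite inE aff_notin_linf. Qed.

Lemma affine_partP P L : P \in affine_part L -> exists x y, P = pgpt x y 1 /\ pgpt x y 1 \in L.
Proof. by rewrite inE => /andP[/affP[x [y ->]] h]; exists x, y. Qed.

Lemma dline_two_pts u v c x y L : (u, v) != (0, 0) ->
  L \in pglines F -> L != linf F ->
  pgpt x y 1 \in dline u v c -> pgpt x y 1 \in L -> pgpt (x + u) (y + v) 1 \in L ->
  L = dline u v c.
Proof.
move=> nz Ll Linf h1 h2 h3.
have [u' [v' [c' [nz' LE]]]] := line_dline Ll Linf.
have [|c2 Ec] := @dlineP L u v Ll Linf nz.
  rewrite LE pgpt_line ?row3_inf // mulr0 addr0 mulNr.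
  move: h2 h3; rewrite LE !aff_dline => /eqP E2 /eqP E3; apply/eqP.
  by rewrite -[RHS](subrr 0) -{1}E3 -E2; ring.
by rewrite Ec; rewrite Ec in h2; rewrite (dline_eq h1 h2).
Qed.

(** A point and its translate by the direction of the line are two affine points
    of the line, which determine it. *)
Lemma affine_part_inj L M :
  L \in pglines F -> L != linf F -> M \in pglines F -> M != linf F ->
  affine_part L = affine_part M -> L = M.
Proof.
move=> Ll Linf Ml Minf E; have [u [v [c [nz LE]]]] := line_dline Ll Linf.
have [x [y h]] := dline_aff c nz.
apply/esym; rewrite LE; apply: (dline_two_pts nz Ml Minf h).
  by rewrite -in_affine_part -E in_affine_part LE.
rewrite -in_affine_part -E in_affine_part LE aff_dline.
by move: h; rewrite aff_dline => /eqP <-; apply/eqP; ring.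
Qed.

End Points.

(** * Equation of a hyperbola *)

(** In the basis of the linear forms y * X - x * Y and y' * X - x' * Y of the line
    at infinity, the equation of K has no square terms as K contains their
    zeros. It has a nonzero mixed term B, otherwise K would contain the whole
    line at infinity. Dividing by B and completing the product leaves a constant
    e, which is nonzero because the conic is irreducible. *)
Lemma hyperbola_equation (F : finFieldType) (K : {set pgpoint F}) (x y x' y' : F) :
  is_conic K -> x * y' != x' * y ->
  pgpt x y 0 \in K -> pgpt x' y' 0 \in K -> (exists2 P, P \in linf F & P \notin K) ->
  exists s0 t0 e, e != 0 /\ forall X Y Z, row3 X Y Z != 0 ->
    (pgpt X Y Z \in K) = ((y * X - x * Y + s0 * Z) * (y' * X - x' * Y + t0 * Z) == e * Z ^+ 2).
Proof.
move=> [Q [hQ irrQ KE]] d0 K1 K2 [P Pinf PK].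
have [a [b [c [d [g [f QP]]]]]] := homog2_quad_poly hQ.
have E := quad_polyE a b c d g f; rewrite -QP in E.
rewrite -subr_eq0 in d0; set D := x * y' - x' * y in d0.
have memK X Y Z : row3 X Y Z != 0 -> (pgpt X Y Z \in K) = (quad_form a b c d g f X Y Z == 0).
  by move=> nz; rewrite KE pgpt_zero_set // E.
have nz1 : row3 x y 0 != 0.
  rewrite row3_inf; apply: contraNneq d0 => -[x0 y0].
  by rewrite /D x0 y0 mul0r mulr0 subrr.
have nz2 : row3 x' y' 0 != 0.
  rewrite row3_inf; apply: contraNneq d0 => -[x0 y0].
  by rewrite /D x0 y0 mul0r mulr0 subrr.
move: K1 K2; rewrite !memK // => /eqP q1 /eqP q2.
pose B := - (2 * a * x * x' + b * (x * y' + x' * y) + 2 * c * y * y') / D ^+ 2.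
pose ds := - (d * x' + g * y') / D; pose dt := (d * x + g * y) / D.
have QE X Y Z : quad_form a b c d g f X Y Z =
    B * (y * X - x * Y) * (y' * X - x' * Y) + ds * (y * X - x * Y) * Z
    + dt * (y' * X - x' * Y) * Z + f * Z ^+ 2.
  apply: (mulfI (expf_neq0 2 d0)).
  transitivity (quad_form a b c d g f x y 0 * (y' * X - x' * Y) ^+ 2
     + quad_form a b c d g f x' y' 0 * (y * X - x * Y) ^+ 2
     + D ^+ 2 * (B * (y * X - x * Y) * (y' * X - x' * Y) + ds * (y * X - x * Y) * Z
    + dt * (y' * X - x' * Y) * Z + f * Z ^+ 2)); last first.
    by rewrite q1 q2 !mul0r !add0r.
  have -> : D ^+ 2 * (B * (y * X - x * Y) * (y' * X - x' * Y) + ds * (y * X - x * Y) * Z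
    + dt * (y' * X - x' * Y) * Z + f * Z ^+ 2) =
     (D ^+ 2 * B) * (y * X - x * Y) * (y' * X - x' * Y) + D * (D * ds) * (y * X - x * Y) * Z
    + D * (D * dt) * (y' * X - x' * Y) * Z + D ^+ 2 * f * Z ^+ 2.
    by ring.
  rewrite /B /ds /dt ![D * (_ / D)]mulrC ![D ^+ 2 * (_ / _)]mulrC !divfK ?expf_neq0 //.
  by rewrite /quad_form /D; ring.
have B0 : B != 0.
  apply: contraNneq PK => B0; have [X [Y [nz ->]]] := infP Pinf.
  by rewrite memK ?row3_inf // QE B0; apply/eqP; ring.
(* The constants that complete the product of the two linear forms. *)
exists (dt / B), (ds / B), (dt / B * (ds / B) - f / B); split.
  apply/eqP => e0.
  apply: (@irreducible_quad_nosplit _ Q (B * y) (- (B * x)) dt y' (- x') (ds / B) hQ irrQ).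
  move=> X Y Z; rewrite E QE.
  have -> : f = B * (dt / B * (ds / B)) by rewrite (subr0_eq e0); field.
  by field.
move=> X Y Z nz; rewrite memK // QE -subr_eq0 -[RHS]subr_eq0.
set l := (X in (X == 0) = _); set r := (X in _ = (X == 0)).
have -> : l = B * r by rewrite /l /r; field.
by rewrite mulf_eq0 (negPf B0).
Qed.

(** * Hyperbolas in asymptotic coordinates *)

Section Hyperbola.
Variables (F : finFieldType) (x y x' y' s0 t0 e : F) (K : {set pgpoint F}).
Hypothesis d0 : x * y' - x' * y != 0.
Hypothesis e0 : e != 0.
Hypothesis memK : forall X Y Z, row3 X Y Z != 0 ->
  (pgpt X Y Z \in K) = ((y * X - x * Y + s0 * Z) * (y' * X - x' * Y + t0 * Z) == e * Z ^+ 2).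
Hypothesis two0 : 2 != 0 :> F.
Implicit Types (r s t u v c : F).

Local Notation D := (x * y' - x' * y).

(** The affine point with coordinates s, t along the asymptotes of the hyperbola
    s * t = e, obtained by inverting the linear change of coordinates of
    [pgpt_asym]. *)
Definition asym_pt s t :=
  pgpt ((x * (t - t0) - x' * (s - s0)) / D) ((y * (t - t0) - y' * (s - s0)) / D) 1.

Lemma pgpt_asym X Y : pgpt X Y 1 = asym_pt (y * X - x * Y + s0) (y' * X - x' * Y + t0).
Proof. by rewrite /asym_pt; congr pgpt; field. Qed.

Lemma asym_pt_inj s t s' t' : asym_pt s t = asym_pt s' t' -> s = s' /\ t = t'.
Proof.
move=> /aff_inj[/(divIf d0) E1 /(divIf d0) E2]; split.
  apply: (addIr (- s0)); apply: (mulIf d0).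
  transitivity (y * (x * (t - t0) - x' * (s - s0)) - x * (y * (t - t0) - y' * (s - s0))).
    by ring.
  by rewrite E1 E2; ring.
apply: (addIr (- t0)); apply: (mulIf d0).
transitivity (y' * (x * (t - t0) - x' * (s - s0)) - x' * (y * (t - t0) - y' * (s - s0))).
  by ring.
by rewrite E1 E2; ring.
Qed.

Lemma asym_pt_hyperbola s t : (asym_pt s t \in K) = (s * t == e).
Proof.
rewrite memK ?row3_aff // expr1n !mulr1; congr (_ == _).
by field.
Qed.

Lemma asym_pt_aff s t : asym_pt s t \notin linf F.
Proof. exact: aff_notin_linf. Qed.

Lemma asym_pt_surj P : P \notin linf F -> exists s t, P = asym_pt s t.
Proof.
case/affP => X [Y ->]; rewrite pgpt_asym.
by exists (y * X - x * Y + s0), (y' * X - x' * Y + t0).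
Qed.

Lemma asym_pt_dline s t u v c : (asym_pt s t \in dline u v c) =
  ((u * y' - v * x') * s + (v * x - u * y) * t
    + (D * c - (u * y' - v * x') * s0 - (v * x - u * y) * t0) == 0).
Proof.
rewrite aff_dline -(inj_eq (mulfI d0)) mulr0; congr (_ == _).
by field.
Qed.

Lemma affine_hyperbola : K :\: linf F = [set asym_pt r (e / r) | r in [set~ 0]].
Proof.
apply/setP => P; rewrite in_setD; apply/andP/imsetP.
  move=> [/asym_pt_surj[s [t ->]]]; rewrite asym_pt_hyperbola => /eqP E.
  have s_n0 : s != 0 by apply: contraNneq e0 => s0'; rewrite -E s0' mul0r.
  by exists s; rewrite ?in_setC1 // -E mulrAC mulfV // mul1r.
case=> r; rewrite in_setC1 => r0 ->; split; first exact: asym_pt_aff.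
by rewrite asym_pt_hyperbola mulrC divfK.
Qed.

Lemma card_hyperbola : #|K| = (#|K :&: linf F| + #|F|.-1)%N.
Proof.
rewrite -(cardsID (linf F) K) affine_hyperbola card_imset ?cardsC1 //.
by move=> r s /asym_pt_inj[].
Qed.

(** Substituting the parametrization r |-> (r, e / r) of the affine part of K into
    the equation of a line, and multiplying by r. *)
Lemma card_dline_aff u v c :
  #|(dline u v c :&: K) :\: linf F| =
  #|[set r | (r != 0) && ((u * y' - v * x') * r ^+ 2
    + (D * c - (u * y' - v * x') * s0 - (v * x - u * y) * t0) * r + (v * x - u * y) * e == 0)]|.
Proof.
rewrite -setIDA affine_hyperbola.
rewrite -[RHS](card_imset _ (f := fun r => asym_pt r (e / r))); last by move=> r s /asym_pt_inj[].
apply: eq_card => P; rewrite in_setI; apply/andP/imsetP.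
  case=> + /imsetP[r]; rewrite in_setC1 => + r0 E; rewrite E asym_pt_dline => /eqP h.
  by exists r => //; rewrite inE r0 /= -(mul0r r) -h; apply/eqP; field.
case=> r; rewrite inE => /andP[r0 /eqP h] ->; split; last first.
  by apply: imset_f; rewrite in_setC1.
by rewrite asym_pt_dline; apply/eqP; apply: (mulIf r0); rewrite mul0r -h; field.
Qed.

Lemma inf_K u v : (u, v) != (0, 0) ->
  (pgpt u v 0 \in K) = (u * y' - v * x' == 0) || (v * x - u * y == 0).
Proof.
move=> nz; rewrite memK ?row3_inf // expr0n !mulr0 !addr0 mulf_eq0 orbC.
rewrite [y' * u]mulrC [x' * v]mulrC [y * u]mulrC [x * v]mulrC; congr (_ || _).
by rewrite -oppr_eq0 opprB.
Qed.

Lemma card_dline_inf u v c : (u, v) != (0, 0) ->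
  #|(dline u v c :&: K) :&: linf F| = (pgpt u v 0 \in K).
Proof.
move=> nz; have hL : pgpt u v 0 \in linf F by rewrite linfE ?row3_inf.
have E P : P \in (dline u v c :&: K) :&: linf F -> P = pgpt u v 0.
  by rewrite !in_setI => /andP[/andP[h1 _] h2]; apply: dline_inf h2 h1.
case: (boolP (pgpt u v 0 \in K)) => hK.
  rewrite (_ : _ :&: linf F = [set pgpt u v 0]) ?cards1 //; apply/setP => P.
  rewrite in_set1; apply/idP/eqP => [/E //|->].
  by rewrite !in_setI inf_dline // hK.
apply: eq_card0 => P; apply/negP => hP; move: (hP); rewrite (E _ hP).
by rewrite !in_setI (negPf hK) andbF.
Qed.

(** The equation of [card_dline_aff] loses a degree for each infinite point of K
    that the line contains, so the bound 2 persists. *)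
Lemma card_dline_hyperbola u v c : (u, v) != (0, 0) -> (#|dline u v c :&: K| <= 2)%N.
Proof.
move=> nz; rewrite -(cardsID (linf F)) card_dline_inf // inf_K // card_dline_aff.
have ab0 : (u * y' - v * x' != 0) || (v * x - u * y != 0).
  rewrite -negb_and; apply: contraNN nz => /andP[/eqP a0 /eqP b0].
  have u0 : u * D = 0.
    transitivity (x * (u * y' - v * x') + x' * (v * x - u * y)); first by ring.
    by rewrite a0 b0 !mulr0 addr0.
  have v0 : v * D = 0.
    transitivity (y * (u * y' - v * x') + y' * (v * x - u * y)); first by ring.
    by rewrite a0 b0 !mulr0 addr0.
  move/eqP: u0; move/eqP: v0; rewrite !mulf_eq0 (negPf d0) !orbF => /eqP-> /eqP->.
  by [].
move: (D * c - _ - _); move: (u * y' - v * x') (v * x - u * y) ab0 => a b ab0 g.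
have [a0|a0] := eqVneq a 0.
  rewrite orTb -[2%N]/(1 + 1)%N leq_add2l.
  have := @card_roots_quad F 0 g (b * e); rewrite eqxx => h.
  apply: leq_trans (h _); last first.
    by move: ab0; rewrite a0 eqxx /= => b0; rewrite negb_and mulf_neq0 ?orbT.
  by apply/subset_leq_card/subsetP => r; rewrite !inE a0 => /andP[].
have [b0|b0] := eqVneq b 0.
  rewrite orbT -[2%N]/(1 + 1)%N leq_add2l.
  have := @card_roots_quad F 0 a g; rewrite eqxx (negPf a0) => /(_ isT) h.
  apply: leq_trans h; apply/subset_leq_card/subsetP => r; rewrite !inE b0 => /andP[r0 h].
  rewrite -(inj_eq (mulIf r0)) mul0r; move: h; congr is_true; congr (_ == _).
    by ring.
  by rewrite mul0r.
rewrite orbF add0n.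
have := @card_roots_quad F a g (b * e); rewrite (negPf a0) => /(_ isT).
apply: leq_trans; apply/subset_leq_card/subsetP => r; rewrite !inE => /andP[//].
Qed.

(** The lines through a point at infinity differ only in the coefficient c of
    [dline]; on each of them tangency is the vanishing of a discriminant, a
    quadratic condition on c. *)
Lemma card_tangents u v : (u, v) != (0, 0) -> pgpt u v 0 \notin K -> #|linf F :&: K| = 2%N ->
  #|[set L in tangents K | pgpt u v 0 \in L]| =
  #|[set r : F | r ^+ 2 == 4 * (u * y' - v * x') * ((v * x - u * y) * e)]|.
Proof.
move=> nz hK linf2.
move: (hK); rewrite inf_K // negb_or => /andP[a0 b0].
pose h := - (u * y' - v * x') * s0 - (v * x - u * y) * t0.
rewrite -(card_affine_image h
  (fun z => z ^+ 2 == 4 * (u * y' - v * x') * ((v * x - u * y) * e)) d0).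
rewrite -[RHS](card_imset _ (f := dline u v)); last first.
  move=> c c' E; have [X [Y hX]] := dline_aff c nz.
  by apply: (dline_eq hX); rewrite -E.
have tanE c : (#|dline u v c :&: K| == 1%N) =
    ((D * c + h) ^+ 2 == 4 * (u * y' - v * x') * ((v * x - u * y) * e)).
  rewrite -(cardsID (linf F)) card_dline_inf // (negPf hK) add0n card_dline_aff.
  rewrite -card_quad_eq1 //; congr (_ == _); apply: eq_card => r; rewrite !inE.
  rewrite (_ : D * c - _ - _ = D * c + h); last by rewrite /h; ring.
  case: eqVneq => // ->; rewrite expr0n !mulr0 !add0r mulf_eq0 (negPf e0) (negPf b0).
  by [].
apply: eq_card => L; rewrite !inE; apply/andP/imsetP.
  move=> [/andP[Ll t1] LP].
  have [Li|Linf] := eqVneq L (linf F); first by move: t1; rewrite Li linf2.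
  have [c Lc] := dlineP Ll Linf nz LP.
  by exists c => //; rewrite inE -tanE -Lc.
case=> c; rewrite inE -tanE => tc ->; split; last exact: inf_dline.
by rewrite dline_line // tc.
Qed.

End Hyperbola.

(** * Conjugation and the Hall plane *)

Section QuadraticExtension.
Variables (F : finFieldType) (q p k : nat).
Hypotheses (p_prime : prime p) (k_gt0 : (0 < k)%N) (q_pow : q = (p ^ k)%N).
Hypotheses (q_odd : odd q) (cardF : #|F| = (q ^ 2)%N).
Implicit Types (a b c u v w x y : F).

Let p_char : p \in [pchar F].
Proof. by apply: (@card_finPcharP _ _ (k * 2)); rewrite ?expnM -?q_pow. Qed.

Lemma q_gt0 : (0 < q)%N. Proof. by case: (q) q_odd. Qed.

Lemma conjD a b : (a + b) ^+ q = a ^+ q + b ^+ q.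
Proof.
apply: exprDn_pchar; rewrite q_pow pnatX; apply/orP; left.
by rewrite pnatE.
Qed.

Lemma conjN a : (- a) ^+ q = - a ^+ q.
Proof. by rewrite exprNn -signr_odd q_odd mulN1r. Qed.

Lemma conjB a b : (a - b) ^+ q = a ^+ q - b ^+ q.
Proof. by rewrite conjD conjN. Qed.

Lemma conjK a : (a ^+ q) ^+ q = a.
Proof. by rewrite -exprM mulnn -cardF expf_card. Qed.

Lemma two_neq0 : 2 != 0 :> F.
Proof.
apply: contraTneq q_odd => two0.
have : 2 \in [pchar F] by rewrite inE /= two0 eqxx.
rewrite (pcharf_eq p_char) => /eqP/= p2.
by rewrite q_pow -p2 oddX negb_or -lt0n k_gt0.
Qed.

Lemma GFqE a : (a \in GFq F q) = (a ^+ q == a).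
Proof. by rewrite inE. Qed.

(** Cramer's rule applied to c = a * u + b * v and its conjugate: the resulting u
    and v are fixed by conjugation. *)
Lemma gfq_span a b : a * b ^+ q != a ^+ q * b ->
  forall c, exists u v, [/\ u \in GFq F q, v \in GFq F q & c = a * u + b * v].
Proof.
rewrite -subr_eq0 => d0 c; set d := _ - _ in d0.
have dq : d ^+ q = - d by rewrite conjB !exprMn !conjK /d; ring.
exists ((c * b ^+ q - c ^+ q * b) / d), ((a * c ^+ q - a ^+ q * c) / d); split.
- rewrite GFqE exprMn exprVn dq conjB !exprMn !conjK; apply/eqP; field.
  by rewrite oppr_eq0 d0.
- rewrite GFqE exprMn exprVn dq conjB !exprMn !conjK; apply/eqP; field.
  by rewrite oppr_eq0 d0.
by rewrite /d; field.
Qed.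

Lemma dersetP P : reflect
  (exists u v, [/\ u \in GFq F q, v \in GFq F q, (u, v) != (0, 0) & P = pgpt u v 0])
  (P \in derset F q).
Proof.
rewrite inE; apply: (iffP existsP) => [[u /andP[uq /existsP[v /andP[vq]]]]|[u [v [uq vq nz ->]]]].
  by rewrite is_ptE row3_inf => /andP[nz /eqP ->]; exists u, v.
exists u; rewrite uq /=; apply/existsP; exists v; rewrite vq /=.
by rewrite is_ptE row3_inf nz /=.
Qed.

(** If a / b is fixed by conjugation then it lies in GF(q), and (a : b : 0) is in
    the derivation set. *)
Lemma notin_derset a b : (a, b) != (0, 0) -> pgpt a b 0 \notin derset F q ->
  a * b ^+ q != a ^+ q * b.
Proof.
move=> nz; apply: contraNneq => E; apply/dersetP.
have [b0|b0] := eqVneq b 0.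
  exists 1, 0; rewrite !GFqE expr1n expr0n -[_ == 0%N]negbK -lt0n q_gt0 /= !eqxx.
  split => //; first by rewrite xpair_eqE oner_eq0.
  have a0 : a != 0 by apply: contraNneq nz => ->; rewrite b0.
  by rewrite -[RHS](pgpt_scale _ _ _ a0) mulr1 !mulr0 b0.
exists (a / b), 1; rewrite !GFqE expr1n eqxx; split => //.
- have bq : b ^+ q != 0 by rewrite expf_eq0 negb_and b0 orbT.
  by rewrite exprMn exprVn eqr_div // -E.
- by rewrite xpair_eqE oner_eq0 andbF.
by rewrite -[RHS](pgpt_scale _ _ _ b0) mulr1 mulr0 mulrC divfK.
Qed.

(** The q ^ 2 - 1 nonzero elements are distributed over at most q - 1 possible
    norms, and each fibre has at most q + 1 elements, the roots of a polynomial.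
    Hence all fibres are full. *)
Lemma card_norm_fiber c : c != 0 -> c ^+ q = c -> #|[set w : F | w ^+ q.+1 == c]| = q.+1.
Proof.
move=> c0 cq; pose G := [set a : F | (a != 0) && (a ^+ q == a)].
have q1 : (1 < q)%N by rewrite q_pow -(exp1n k) ltn_exp2r // prime_gt1.
have roots_le (f : {poly F}) (A : {set F}) m : f != 0 -> (size f <= m.+1)%N ->
    (forall a, a \in A -> root f a) -> (#|A| <= m)%N.
  move=> f0 sf Ar; rewrite cardE -ltnS; apply: leq_trans sf.
  apply: max_poly_roots => //; last exact: enum_uniq.
  by apply/allP => a; rewrite mem_enum => /Ar.
have leG : (#|G| <= q.-1)%N.
  have q1' : (0 < q.-1)%N by rewrite -ltnS prednK ?q_gt0.
  apply: (roots_le ('X^(q.-1) - 1%:P) G); first by rewrite -size_poly_eq0 size_XnsubC.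
    by rewrite size_XnsubC.
  move=> a; rewrite inE /root !hornerE => /andP[a0 /eqP aq].
  by rewrite subr_eq0 -(inj_eq (mulIf a0)) mul1r -exprSr prednK ?q_gt0 // aq.
pose f a := #|[set w : F | w ^+ q.+1 == a]|.
have lef a : a \in G -> (f a <= q.+1 ?= iff (f a == q.+1))%N.
  move=> _; apply/leqif_eq/(roots_le ('X^(q.+1) - a%:P)).
  - by rewrite -size_poly_eq0 size_XnsubC.
  - by rewrite size_XnsubC.
  by move=> w; rewrite inE /root !hornerE subr_eq0.
have sumf : (\sum_(a in G) f a = q.-1 * q.+1)%N.
  transitivity #|[set~ (0 : F)]|; last first.
    by rewrite cardsC1 cardF -mulnn; have := q_gt0; nia.
  rewrite -sum1_card [RHS](partition_big (fun w : F => w ^+ q.+1) (fun a => a \in G)) /= => [|w].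
    apply: eq_bigr => a; rewrite inE => /andP[a0 _]; rewrite /f -sum1_card.
    apply: eq_bigl => w; rewrite !inE andb_idl // => /eqP wa.
    by apply: contraNneq a0 => w0; rewrite -wa w0 expr0n.
  rewrite !inE => w0; rewrite expf_eq0 /= w0 /=.
  by rewrite exprSr exprMn conjK mulrC.
have := leqif_sum lef; rewrite sumf sum_nat_const => -[le /esym].
rewrite eqn_leq le leq_mul2r leG orbT => /forallP/(_ c)/implyP.
by rewrite inE c0 cq eqxx => /(_ isT)/eqP.
Qed.

Lemma new_lineP a b l P : reflect
  (exists u v, [/\ u \in GFq F q, v \in GFq F q & P = pgpt (a + l * u) (b + l * v) 1])
  (P \in new_line q a b l).
Proof.
rewrite inE; apply: (iffP existsP) => [[u /andP[uq /existsP[v /andP[vq]]]]|[u [v [uq vq ->]]]].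
  by rewrite is_ptE => /andP[nz /eqP ->]; exists u, v.
exists u; rewrite uq /=; apply/existsP; exists v; rewrite vq /=.
by rewrite is_ptE row3_aff /=.
Qed.

Lemma GFq0 : 0 \in GFq F q.
Proof. by rewrite GFqE expr0n -[_ == 0%N]negbK -lt0n q_gt0. Qed.

Lemma GFq1 : 1 \in GFq F q.
Proof. by rewrite GFqE expr1n. Qed.

Lemma disjoint_derset u v c : (u, v) != (0, 0) ->
  [disjoint dline u v c & derset F q] = (pgpt u v 0 \notin derset F q).
Proof.
move=> nz; apply/idP/idP => [/disjointFr->//|]; first exact: inf_dline.
move=> nD; rewrite -setI_eq0; apply/eqP/setP => P; rewrite in_setI in_set0.
apply/negP => /andP[PL PD]; case/negP: nD.
rewrite -(dline_inf nz _ PL) //.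
by case/dersetP: PD => u' [v' [_ _ nz' ->]]; rewrite linfE ?row3_inf.
Qed.

(** The coordinates of the direction (u : v : 0) of an old line span the field over
    GF(q), so its equation can be solved along the new line. This keeps the new
    lines out of the parallel classes of old lines. *)
Lemma new_meets_old u v c a b l :
  (u, v) != (0, 0) -> pgpt u v 0 \notin derset F q -> l != 0 ->
  exists2 P, P \in new_line q a b l & P \in affine_part (dline u v c).
Proof.
move=> nz nD l0; have := notin_derset nz nD => E.
have [|s [t [sq tq e]]] := @gfq_span v (- u) _ (- (c + v * a - u * b) / l).
  by rewrite conjN !mulrN eqr_opp eq_sym [v ^+ q * _]mulrC [v * _]mulrC.
exists (pgpt (a + l * s) (b + l * t) 1); first by apply/new_lineP; exists s, t.
rewrite in_affine_part aff_dline.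
rewrite (_ : _ + c = l * (v * s + - u * t) + (c + v * a - u * b)); last by ring.
by rewrite -e; apply/eqP; field.
Qed.

(** A new line contains two affine points with the same second coordinate, and the
    line through them meets the derivation set in (1 : 0 : 0). *)
Lemma new_neq_old u v c a b l :
  (u, v) != (0, 0) -> pgpt u v 0 \notin derset F q -> l != 0 ->
  new_line q a b l <> affine_part (dline u v c).
Proof.
move=> nz nD l0 E.
have [h0 h1] : pgpt a b 1 \in dline u v c /\ pgpt (a + l) (b + 0) 1 \in dline u v c.
  split; rewrite -in_affine_part -E; apply/new_lineP.
    by exists 0, 0; split; rewrite ?mulr0 ?addr0 //; apply: GFq0.
  exists 1, 0; split; [exact: GFq1 | exact: GFq0 | by rewrite mulr1 mulr0].
have nz' : (l, 0 : F) != (0, 0) by rewrite xpair_eqE negb_and l0.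
have h0' : pgpt a b 1 \in dline l 0 (l * b) by rewrite aff_dline; apply/eqP; ring.
have := dline_two_pts nz' (dline_line c nz) (dline_neq_linf c nz) h0' h0 h1 => e.
have := disjoint_derset c nz; rewrite nD e disjoint_derset // => /negP; apply.
apply/dersetP; exists 1, 0; rewrite GFq0 GFq1 xpair_eqE oner_eq0; split => //.
by rewrite -[RHS](pgpt_scale _ _ _ l0) !mulr0 mulr1.
Qed.

Lemma old_linesP m : reflect
  (exists u v c, [/\ (u, v) != (0, 0), pgpt u v 0 \notin derset F q
     & m = affine_part (dline u v c)])
  (m \in old_lines F q).
Proof.
apply: (iffP imsetP) => [[L]|[u [v [c [nz nD ->]]]]].
  rewrite inE => /and3P[Ll Linf LD ->].
  have [u [v [c [nz e]]]] := line_dline Ll Linf.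
  by exists u, v, c; rewrite -(disjoint_derset c) // -e.
exists (dline u v c) => //.
by rewrite inE dline_line // dline_neq_linf // disjoint_derset.
Qed.

Lemma old_classP u v m : (u, v) != (0, 0) ->
  reflect (exists c, m = affine_part (dline u v c)) (m \in old_class (pgpt u v 0)).
Proof.
move=> nz; apply: (iffP imsetP) => [[L]|[c ->]].
  rewrite inE => /and3P[Ll Linf LP ->].
  by have [c ->] := dlineP Ll Linf nz LP; exists c.
exists (dline u v c) => //.
by rewrite inE dline_line // dline_neq_linf // inf_dline.
Qed.

Lemma new_notin_old_class a b l u v :
  (u, v) != (0, 0) -> pgpt u v 0 \notin derset F q -> l != 0 ->
  new_line q a b l \notin old_class (pgpt u v 0).
Proof.
by move=> nz nD l0; apply/old_classP => // -[c]; apply: new_neq_old.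
Qed.

Lemma new_linesP m : reflect (exists a b l, l != 0 /\ m = new_line q a b l) (m \in new_lines F q).
Proof.
rewrite inE; apply: (iffP existsP) => [[a /existsP[b /existsP[l /andP[l0 /eqP ->]]]]|].
  by exists a, b, l.
case=> a [b [l [l0 ->]]]; exists a; apply/existsP; exists b; apply/existsP; exists l.
by rewrite l0 /=.
Qed.

(** Parallelism in the Hall plane restricted to old lines is that of the original
    plane, which justifies identifying an infinite point off the derivation set
    with its class of old lines. *)
Lemma par_class_old u v c : (u, v) != (0, 0) -> pgpt u v 0 \notin derset F q ->
  par_class (hall_affine_lines F q) (affine_part (dline u v c)) = old_class (pgpt u v 0).
Proof.
move=> nz nD; apply/setP => m; apply/idP/old_classP => //.
  rewrite inE in_setU => /andP[/orP[/old_linesP|/new_linesP]].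
    move=> [u' [v' [c' [nz' nD' ->]]]] /orP[/eqP->|dis]; first by exists c.
    have [E|ne] := eqVneq (u' * v) (u * v').
      have [||||c2 ->] := @dlineP F (dline u' v' c') u v => //; last by exists c2.
      - exact: dline_line.
      - exact: dline_neq_linf.
      by rewrite pgpt_line ?row3_inf // mulr0 addr0 mulNr E mulrC subrr.
    have [x [y [h1 h2]]] := dline_meet c' c ne.
    have := disjointFr dis (_ : pgpt x y 1 \in _).
    by rewrite !in_affine_part h1 h2 => /(_ isT).
  move=> [a [b [l [l0 ->]]]] /orP[/eqP|dis]; first by move/(new_neq_old nz nD l0).
  have [P P1 P2] := new_meets_old c a b nz nD l0.
  by have := disjointFr dis P1; rewrite P2.
case=> c' ->; rewrite inE in_setU; apply/andP; split.
  by apply/orP; left; apply/old_linesP; exists u, v, c'.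
have [->|ne] := eqVneq c' c; first by rewrite eqxx.
apply/orP; right; rewrite -setI_eq0; apply/eqP/setP => P; rewrite in_setI in_set0.
apply/negP => /andP[/affine_partP[x [y [-> h1]]]]; rewrite in_affine_part => h2.
by rewrite (dline_eq h1 h2) eqxx in ne.
Qed.

Lemma old_class_inj u v u' v' : (u, v) != (0, 0) -> (u', v') != (0, 0) ->
  old_class (pgpt u v 0) = old_class (pgpt u' v' 0) -> pgpt u v 0 = pgpt u' v' 0.
Proof.
move=> nz nz' E.
have /old_classP[//|c e] : affine_part (dline u v 0) \in old_class (pgpt u' v' 0).
  by rewrite -E; apply/old_classP => //; exists 0.
have e' := affine_part_inj (dline_line _ nz) (dline_neq_linf _ nz)
  (dline_line _ nz') (dline_neq_linf _ nz') e.
apply: (dline_inf nz' _ (c := c)); first by rewrite linfE ?row3_inf.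
by rewrite -e' inf_dline.
Qed.

Lemma hall_pt_inj : injective (@hall_pt F).
Proof.
move=> P R; rewrite /hall_pt; case: ifPn => hP; case: ifPn => hR // -[] //.
have [u [v [nz ->]]] := infP hP; have [u' [v' [nz' ->]]] := infP hR.
exact: old_class_inj.
Qed.

(** * Hyperbolas with conjugate infinite points *)

Section ConjugateHyperbola.
Hypothesis q_gt3 : (3 < q)%N.
Variables (x y s0 t0 e : F) (K : {set pgpoint F}).
Local Notation x' := (x ^+ q).
Local Notation y' := (y ^+ q).
Local Notation D := (x * y' - x' * y).
Hypothesis d0 : D != 0.
Hypothesis e0 : e != 0.
Hypothesis memK : forall X Y Z, row3 X Y Z != 0 ->
  (pgpt X Y Z \in K) = ((y * X - x * Y + s0 * Z) * (y' * X - x' * Y + t0 * Z) == e * Z ^+ 2).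
Hypothesis K_inf : K :&: linf F = [set pgpt x y 0; pgpt x' y' 0].
Hypothesis nD1 : pgpt x y 0 \notin derset F q.
Hypothesis nD2 : pgpt x' y' 0 \notin derset F q.
Implicit Types (l m n r s t : F).

Local Notation ap := (asym_pt x y x' y' s0 t0).

Let ap_inj := @asym_pt_inj F x y x' y' s0 t0 d0.
Let ap_K := @asym_pt_hyperbola F x y x' y' s0 t0 e K d0 memK.
Let ap_pgpt := @pgpt_asym F x y x' y' s0 t0 d0.

Let DqN : D ^+ q = - D.
Proof. by rewrite conjB !exprMn !conjK; ring. Qed.

(** From D' = - D one gets D ^+ q.-1 = -1, an even power of D. *)
Lemma neg1_square : exists i : F, i ^+ 2 = -1.
Proof.
exists (D ^+ q./2); rewrite -exprM muln2; apply: (mulIf d0).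
rewrite -exprSr mulN1r -DqN; congr (_ ^+ _).
by rewrite -[RHS]odd_double_half q_odd.
Qed.

Lemma norm_square w : (w ^+ (q.+1)./2) ^+ 2 = w ^+ q.+1.
Proof. by rewrite -exprM muln2 even_halfK //= q_odd. Qed.

Definition is_square a := [exists r, r ^+ 2 == a].

Lemma is_square_mul s a : s != 0 -> is_square (s ^+ 2 * a) = is_square a.
Proof.
move=> s_n0; apply/existsP/existsP => -[r /eqP rE].
  exists (r / s); rewrite expr_div_n rE [s ^+ 2 * a]mulrC mulfK //.
  by rewrite expf_eq0.
by exists (s * r); rewrite exprMn rE.
Qed.

Let P12_neq : pgpt x y 0 != pgpt x' y' 0.
Proof.
have nzD a b a' b' : a * b' - a' * b != 0 -> row3 a b 0 != 0.
  by rewrite row3_inf; apply: contraNneq => -[-> ->]; rewrite mul0r mulr0 subrr.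
apply/eqP => /pgpt_eq[||m [xE yE _]]; first exact: nzD d0.
  by apply: (nzD _ _ x y); rewrite -oppr_eq0 opprB mulrC [x' * _]mulrC mulrC [y * _]mulrC.
by case/negP: d0; rewrite {1}xE {2}yE; apply/eqP; ring.
Qed.

Let card_linf_K : #|linf F :&: K| = 2%N.
Proof. by rewrite setIC K_inf cards2 P12_neq. Qed.

(** For u, v in GF(q) the two coefficients in [card_tangents] are w' and - w with
    w = u * y - v * x, so the discriminant is e times the square of
    2 * i * w ^+ (q.+1)./2, where i is a square root of -1. *)
Lemma card_derset_tangents P : P \in derset F q ->
  P \notin K /\ #|[set L in tangents K | P \in L]| = if is_square e then 2%N else 0%N.
Proof.
move=> PD; have /dersetP[u [v [uq vq nz PE]]] := PD.
have Plinf : P \in linf F by rewrite PE linfE ?row3_inf.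
have PK : P \notin K.
  apply/negP => PK; have : P \in K :&: linf F by rewrite in_setI PK.
  rewrite K_inf in_set2 => /orP[]/eqP E; [move: nD1|move: nD2]; by rewrite -E PD.
split => //; rewrite PE in PK *.
rewrite (card_tangents d0 e0 memK two_neq0 nz PK card_linf_K).
move: PK; rewrite (inf_K memK) // negb_or => /andP[a0 b0].
move: uq vq; rewrite !GFqE => /eqP uq /eqP vq.
have [i i2] := neg1_square.
pose w := u * y - v * x; pose n := w ^+ (q.+1)./2.
have aE : u * y' - v * x' = w ^+ q by rewrite /w conjB !exprMn uq vq.
have -> : 4 * (u * y' - v * x') * ((v * x - u * y) * e) = (2 * i * n) ^+ 2 * e.
  by rewrite aE !exprMn i2 norm_square (exprS w q) /w; ring.
have w0 : w != 0 by move: b0; rewrite /w -opprB oppr_eq0.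
have s_n0 : 2 * i * n != 0.
  rewrite !mulf_neq0 ?two_neq0 // ?expf_neq0 //.
  by rewrite -sqrf_eq0 i2 oppr_eq0 oner_eq0.
rewrite (card_sqrt two_neq0) mulf_eq0 sqrf_eq0 (negPf s_n0) (negPf e0) /=.
by rewrite -/(is_square (_ * _)) is_square_mul.
Qed.

(** On vectors over GF(q) the two asymptotic linear forms take conjugate values w
    and w', and w = y * u - x * v runs over the whole field by [gfq_span]. *)
Lemma new_line_asymP a b l P : reflect
  (exists w, P = ap (y * a - x * b + s0 + l * w) (y' * a - x' * b + t0 + l * w ^+ q))
  (P \in new_line q a b l).
Proof.
apply: (iffP (new_lineP _ _ _ _)) => [[u [v []]]|[w ->]].
  rewrite !GFqE => /eqP uq /eqP vq ->; exists (y * u - x * v); rewrite ap_pgpt.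
  by apply: (f_equal2 ap); rewrite ?conjB ?exprMn ?uq ?vq; ring.
have [|u [v [uq vq wE]]] := @gfq_span y (- x) _ w.
  rewrite conjN !mulrN eqr_opp eq_sym [y ^+ q * x]mulrC [y * _]mulrC.
  by rewrite -subr_eq0.
exists u, v; split => //; rewrite ap_pgpt.
move: uq vq; rewrite !GFqE => /eqP uq /eqP vq.
by apply: (f_equal2 ap); rewrite wE ?conjD ?exprMn ?conjN ?uq ?vq; ring.
Qed.

(** The locus t = r * s' : for r of norm 1 these are the new lines through the
    centre s = t = 0 of the hyperbola. *)
Definition twisted_line r : {set pgpoint F} := [set ap s (r * s ^+ q) | s : F].

Lemma twisted_line_inj : injective twisted_line.
Proof.
move=> r r' E; have : ap 1 (r * 1 ^+ q) \in twisted_line r' by rewrite -E; apply: imset_f.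
by case/imsetP => s _ /ap_inj[<-]; rewrite expr1n !mulr1.
Qed.

Lemma card_twisted_line r : #|twisted_line r :&: K| = #|[set m : F | r * m ^+ q.+1 == e]|.
Proof.
rewrite -[RHS](card_imset _ (f := fun s => ap s (r * s ^+ q))); last by move=> s t /ap_inj[].
apply: eq_card => P; rewrite in_setI; apply/andP/imsetP.
  case=> /imsetP[s _ ->]; rewrite ap_K => h; exists s => //.
  by rewrite inE exprS mulrCA.
by case=> s; rewrite inE exprS mulrCA => h ->; rewrite ap_K; split => //; apply: imset_f.
Qed.

Lemma new_line_twisted a b l : l != 0 ->
  y' * a - x' * b + t0 = l / l ^+ q * (y * a - x * b + s0) ^+ q ->
  new_line q a b l = twisted_line (l / l ^+ q).
Proof.
move=> l0; have lq0 : l ^+ q != 0 by rewrite expf_neq0.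
set A := y * a - _ + _; set B := y' * a - _ + _ => BE.
apply/setP => P; apply/new_line_asymP/imsetP => [[w ->]|[s _ ->]].
  exists (A + l * w) => //; apply: (f_equal2 ap) => //; rewrite -/B BE (conjD A) exprMn.
  by field.
exists ((s - A) / l); rewrite -/A -/B; apply: (f_equal2 ap); first by field.
by rewrite BE expr_div_n (conjB s A); field; rewrite ?l0 ?lq0.
Qed.

(** The new line is based at the centre of the hyperbola. *)
Lemma twisted_line_new l : l != 0 -> twisted_line (l / l ^+ q) \in new_lines F q.
Proof.
move=> l0; apply/new_linesP.
exists ((x * - t0 - x' * - s0) / D), ((y * - t0 - y' * - s0) / D), l; split => //.
apply/esym/new_line_twisted => //.
rewrite [X in _ = _ * X ^+ q](_ : _ = 0); last by field.
by rewrite expr0n eqn0Ngt q_gt0 mulr0; field.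
Qed.

(** A new line off the centre is t = r * s' + g with g != 0. A common point with
    s * t = e satisfies g * s = e - r * N where N = s ^+ q.+1, so N determines s.
    Multiplying by the conjugate equation shows that N is a root of a monic
    quadratic polynomial, because N' = N and r * r' = 1. *)
Lemma card_new_line a b l : l != 0 ->
  y' * a - x' * b + t0 != l / l ^+ q * (y * a - x * b + s0) ^+ q ->
  (#|new_line q a b l :&: K| <= 2)%N.
Proof.
move=> l0; have lq0 : l ^+ q != 0 by rewrite expf_neq0.
rewrite -subr_eq0.
set A := y * a - _ + _; set B := y' * a - _ + _; set r := l / _; set g := B - _ => g0.
have rq : r * r ^+ q = 1 by rewrite /r expr_div_n conjK; field; rewrite l0.
pose c := - (e * r ^+ q + e ^+ q * r + g ^+ q.+1).
have := @card_roots_quad F 1 c (e ^+ q.+1).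
rewrite oner_eq0 => /(_ isT); apply: leq_trans.
have gE m : m * (r * m ^+ q + g) = e -> g * m = e - r * m ^+ q.+1.
  by move=> <-; rewrite exprS; ring.
pose S := [set m : F | m * (r * m ^+ q + g) == e].
have cardN : #|[set m ^+ q.+1 | m in S]| = #|S|.
  apply: card_in_imset => m n; rewrite !inE => /eqP/gE m1 /eqP/gE n1 E.
  by apply: (mulfI g0); rewrite m1 n1 E.
have -> : #|new_line q a b l :&: K| = #|S|.
  rewrite -(card_imset S (f := fun m => ap m (r * m ^+ q + g))); last by move=> m n /ap_inj[].
  apply: eq_card => P; rewrite in_setI; apply/andP/imsetP => [[]|[m]].
    case/new_line_asymP => w ->; rewrite -/A -/B.
    have tE : B + l * w ^+ q = r * (A + l * w) ^+ q + g.
      by rewrite (conjD A) exprMn /g /r; field.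
    by rewrite tE ap_K => h; exists (A + l * w) => //; rewrite inE.
  rewrite inE => h ->; rewrite ap_K h; split => //; apply/new_line_asymP.
  exists ((m - A) / l); rewrite -/A -/B; apply: (f_equal2 ap); first by field.
  by rewrite expr_div_n (conjB m A) /g /r; field; rewrite ?l0 ?lq0.
rewrite -cardN; apply: subset_leq_card; apply/subsetP => n /imsetP[m]; rewrite !inE => /eqP mS ->.
have nq : (m ^+ q.+1) ^+ q = m ^+ q.+1 by rewrite exprS exprMn conjK mulrC.
move: (gE m mS) nq; set N := m ^+ q.+1 => mE nq.
have mEq : g ^+ q * m ^+ q = e ^+ q - r ^+ q * N by rewrite -exprMn mE conjB exprMn nq.
have NE : g ^+ q.+1 * N = (e - r * N) * (e ^+ q - r ^+ q * N).
  by rewrite -mE -mEq /N !exprS; ring.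
apply/eqP; rewrite mul1r /c.
transitivity ((e - r * N) * (e ^+ q - r ^+ q * N) - g ^+ q.+1 * N + (1 - r * r ^+ q) * N ^+ 2).
  by rewrite (exprS e q); ring.
by rewrite NE rq !subrr mul0r addr0.
Qed.

Lemma new_line_cases N : N \in new_lines F q ->
  (#|N :&: K| <= 2)%N \/ exists2 l, l != 0 & N = twisted_line (l / l ^+ q).
Proof.
case/new_linesP => a [b [l [l0 ->]]].
have [E|ne] := eqVneq (y' * a - x' * b + t0) (l / l ^+ q * (y * a - x * b + s0) ^+ q).
  by right; exists l => //; apply: new_line_twisted.
by left; apply: card_new_line.
Qed.

(** At a common point r * m ^+ q.+1 = e with r = l / l'. Both r =
    l ^+ 2 / l ^+ q.+1 and the norm of m are squares, hence so is e. Dividing the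
    equation by its conjugate eliminates m and gives r ^+ 2 = e / e'. *)
Lemma twisted_line_meets l : l != 0 -> (0 < #|twisted_line (l / l ^+ q) :&: K|)%N ->
  exists2 s, s ^+ 2 = e & l / l ^+ q = s / s ^+ q \/ l / l ^+ q = - (s / s ^+ q).
Proof.
move=> l0; have lq0 : l ^+ q != 0 by rewrite expf_neq0.
rewrite card_twisted_line card_gt0 => /set0Pn[m]; rewrite inE => /eqP mE.
have m0 : m != 0 by apply: contraNneq e0 => m0; rewrite -mE m0 expr0n mulr0.
pose s := l / l ^+ (q.+1)./2 * m ^+ (q.+1)./2.
have s2 : s ^+ 2 = e.
  rewrite exprMn expr_div_n !norm_square -mE; congr (_ * _); rewrite (exprS l q).
  by field; rewrite ?l0 ?lq0.
have s_n0 : s != 0 by rewrite -sqrf_eq0 s2.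
exists s => //.
suff : (l / l ^+ q) ^+ 2 == (s / s ^+ q) ^+ 2.
  by rewrite eqf_sqr => /orP[]/eqP; [left | right].
rewrite !expr_div_n.
have eq0 : e ^+ q != 0 by rewrite expf_neq0.
rewrite [(s ^+ q) ^+ 2]exprAC s2 -mE exprMn expr_div_n conjK.
have -> : (m ^+ q.+1) ^+ q = m ^+ q.+1 by rewrite exprS exprMn conjK mulrC.
apply/eqP; field; rewrite ?l0 ?lq0 ?expf_neq0 //.
Qed.

(** With e = s ^+ 2 the equation r * m ^+ q.+1 = e becomes m ^+ q.+1 = s ^+ q.+1
    or m ^+ q.+1 = - s ^+ q.+1, whose right-hand sides are in GF(q). *)
Lemma card_twisted_line_sqrt s : s ^+ 2 = e ->
  #|twisted_line (s / s ^+ q) :&: K| = q.+1 /\ #|twisted_line (- (s / s ^+ q)) :&: K| = q.+1.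
Proof.
move=> s2; have s_n0 : s != 0 by rewrite -sqrf_eq0 s2.
have sq0 : s ^+ q != 0 by rewrite expf_neq0.
split; rewrite card_twisted_line.
  rewrite -[RHS](card_norm_fiber (c := s ^+ q.+1)) ?expf_neq0 //; last first.
    by rewrite exprS exprMn conjK mulrC.
  apply: eq_card => m; rewrite !inE -s2 -[RHS](inj_eq (mulfI (mulf_neq0 s_n0 (invr_neq0 sq0)))).
  by congr (_ == _); rewrite (exprS s q); field.
rewrite -[RHS](card_norm_fiber (c := - s ^+ q.+1)); first last.
- by rewrite conjN exprS exprMn conjK mulrC.
- by rewrite oppr_eq0 expf_neq0.
apply: eq_card => m; rewrite !inE -s2 -[RHS](inj_eq (mulfI (mulf_neq0 s_n0 (invr_neq0 sq0)))).
rewrite -[RHS](inj_eq oppr_inj).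
by congr (_ == _); rewrite ?(exprS s q); field.
Qed.

(** The scaling factor s gives r = s / s', and s * D gives its opposite since
    D' = - D. *)
Lemma twisted_line_sqrt_new s : s ^+ 2 = e ->
  twisted_line (s / s ^+ q) \in new_lines F q /\ twisted_line (- (s / s ^+ q)) \in new_lines F q.
Proof.
move=> s2; have s_n0 : s != 0 by rewrite -sqrf_eq0 s2.
have sq0 : s ^+ q != 0 by rewrite expf_neq0.
split; first exact: twisted_line_new.
have -> : - (s / s ^+ q) = (s * D) / (s * D) ^+ q.
  by rewrite exprMn DqN mulrN invrN mulrN -mulf_div divff // mulr1.
by apply: twisted_line_new; rewrite mulf_neq0.
Qed.

Let K_infP R : R \in K -> R \in linf F ->
  exists u v, [/\ (u, v) != (0, 0), R = pgpt u v 0 & pgpt u v 0 \notin derset F q].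
Proof.
move=> RK Ri; have [u [v [nz E]]] := infP Ri; exists u, v; split => //.
have : R \in K :&: linf F by rewrite in_setI RK.
by rewrite K_inf in_set2 -E => /orP[]/eqP->.
Qed.

Local Notation HL := (hall_affine_lines F q).

Lemma card_closure_infty : (#|closure_infty HL :&: hall_set K| <= 2)%N.
Proof.
rewrite -card_linf_K setIC -(card_imset _ hall_pt_inj) subset_leq_card //.
apply/subsetP => z; rewrite in_setI => /andP[/imsetP[R RK ->] /imsetP[m _]].
rewrite /hall_pt; case: ifP => // Ri _; apply/imsetP; exists R; first by rewrite in_setI Ri.
by rewrite /hall_pt Ri.
Qed.

(** The infinite point of the Hall line is the class of its own direction, so the
    points of K on the Hall line are among those on the original line. *)
Lemma card_closure_old u v c : (u, v) != (0, 0) -> pgpt u v 0 \notin derset F q ->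
  (#|closure_line HL (affine_part (dline u v c)) :&: hall_set K| <= 2)%N.
Proof.
move=> nz nD; apply: leq_trans (@card_dline_hyperbola F x y x' y' s0 t0 e K d0 e0 memK u v c nz).
rewrite -(card_imset (_ :&: K) hall_pt_inj) subset_leq_card //.
apply/subsetP => z; rewrite in_setI => /andP[+ /imsetP[R RK zR]].
rewrite zR => h; apply: imset_f; rewrite in_setI RK andbT; move: h.
rewrite /closure_line in_setU1 (par_class_old c nz nD) /hall_pt.
case: ifPn => Ri /orP[].
- have [u' [v' [nz' -> _]]] := K_infP RK Ri; move=> /eqP[] /(old_class_inj nz' nz) ->.
  exact: inf_dline.
- by case/imsetP.
- by [].
by case/imsetP => P + [->]; rewrite inE => /andP[].
Qed.

(** The infinite point of a new line does not count: its class contains a new line,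
    unlike the classes that represent the infinite points of K. *)
Lemma card_closure_new N : N \in new_lines F q ->
  #|closure_line HL N :&: hall_set K| = #|N :&: K|.
Proof.
move=> Nn; have /new_linesP[a [b [l [l0 NE]]]] := Nn.
have Naff P : P \in N -> P \notin linf F.
  by rewrite NE => /new_lineP[u [v [_ _ ->]]]; apply: aff_notin_linf.
rewrite -(card_imset _ hall_pt_inj); apply: eq_card => z.
rewrite in_setI in_setU1; apply/andP/imsetP => [[+ /imsetP[R RK zR]]|[R]].
  rewrite zR => /orP[/eqP|]; last first.
    case/imsetP => P PN E; exists R => //; rewrite in_setI RK andbT.
    by move: E; rewrite /hall_pt; case: ifP => // _ [->].
  rewrite /hall_pt; case: ifP => // Ri [] E.
  have [u [v [nz RE nD]]] := K_infP RK Ri.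
  have : N \in par_class HL N by rewrite inE in_setU Nn orbT eqxx.
  by rewrite -E RE NE (negPf (new_notin_old_class a b nz nD l0)).
rewrite in_setI => /andP[RN RK] ->; split; last exact: imset_f.
by apply/orP; right; rewrite /hall_pt (negPf (Naff _ RN)); apply: imset_f.
Qed.

Lemma hall_line_cases L : L \in hall_lines F q ->
  (#|L :&: hall_set K| <= 2)%N \/ exists2 N, N \in new_lines F q & L = closure_line HL N.
Proof.
rewrite in_setU1 => /orP[/eqP->|]; first by left; apply: card_closure_infty.
case/imsetP => m; rewrite in_setU => /orP[mo|mn] ->; last by right; exists m.
by have /old_linesP[u [v [c [nz nD ->]]]] := mo; left; apply: card_closure_old.
Qed.

Lemma closure_line_inj : injective (closure_line HL).
Proof.
move=> M N E; apply/setP => P.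
have h (A : {set pgpoint F}) : (P \in A) = (inl P \in closure_line HL A).
  by rewrite in_setU1 /= mem_imset //; apply: inl_inj.
by rewrite !h E.
Qed.

Lemma hall_set_sub : hall_set K \subset hall_points F q.
Proof.
apply/subsetP => z /imsetP[R RK ->]; rewrite /hall_pt in_setU; case: ifPn => Ri; apply/orP.
  right; have [u [v [nz -> nD]]] := K_infP RK Ri.
  rewrite -(par_class_old 0 nz nD); apply: imset_f.
  by rewrite in_setU; apply/orP; left; apply/old_linesP => //; exists u, v, 0.
by left; apply: imset_f; rewrite in_setC.
Qed.

Lemma card_hall_set : #|hall_set K| = (q ^ 2).+1.
Proof.
rewrite (card_imset _ hall_pt_inj) (card_hyperbola d0 e0 memK) setIC card_linf_K cardF.
by rewrite add2n prednK // expn_gt0 q_gt0.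
Qed.

Lemma oval_of_nonsquare : ~~ is_square e ->
  is_oval (hall_points F q) (hall_lines F q) (q ^ 2) (hall_set K).
Proof.
move=> ns; split; [exact: hall_set_sub | exact: card_hall_set |].
move=> z1 z2 z3 h1 h2 h3 n12 n23 n13; apply/existsP => -[L /and4P[LH L1 L2 L3]].
have : (#|L :&: hall_set K| <= 2)%N.
  case: (hall_line_cases LH) => // -[N Nn ->]; rewrite card_closure_new //.
  case: (new_line_cases Nn) => // -[l l0 ->]; apply: contraNT ns; rewrite -ltnNge => lt2.
  have [|s s2 _] := twisted_line_meets l0; first exact: leq_trans lt2.
  by apply/existsP; exists s; rewrite s2.
rewrite leqNgt => /negP; apply.
apply: (@leq_trans #|[set z1; z2; z3]|); last first.
  apply/subset_leq_card/subsetP => z; rewrite !inE -orbA.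
  by case/or3P => /eqP->; rewrite ?L1 ?L2 ?L3 ?h1 ?h2 ?h3.
by rewrite -setUA cardsU1 cards2 !inE negb_or n12 n13 n23.
Qed.

(** As q + 1 > 2, a line with q + 1 points must be one of the new lines through the
    centre, and only r = s / s' and its opposite give lines that meet K. *)
Lemma two_secants_of_square : is_square e ->
  #|[set L in hall_lines F q | #|L :&: hall_set K| == q.+1]| = 2%N.
Proof.
case/existsP => s /eqP s2; have [n1 n2] := twisted_line_sqrt_new s2.
have [c1 c2] := card_twisted_line_sqrt s2.
set N1 := twisted_line (s / _) in n1 c1; set N2 := twisted_line (- _) in n2 c2.
have inH N : N \in new_lines F q -> closure_line HL N \in hall_lines F q.
  by move=> Nn; rewrite in_setU1; apply/orP; right; apply: imset_f; rewrite in_setU Nn orbT.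
have q2 : (2 < q.+1)%N by rewrite ltnS; exact: ltnW (ltnW q_gt3).
have -> : [set L in hall_lines F q | #|L :&: hall_set K| == q.+1]
   = [set closure_line HL N1; closure_line HL N2].
  apply/setP => L; rewrite in_set2 inE; apply/andP/orP => [[LH /eqP cL]|].
    case: (hall_line_cases LH) => [|[N Nn LN]]; first by rewrite cL leqNgt q2.
    move: cL; rewrite LN card_closure_new // => cN.
    case: (new_line_cases Nn) => [|[l l0 NE]]; first by rewrite cN leqNgt q2.
    have [|s' s2' E] := twisted_line_meets l0; first by rewrite -NE cN.
    have ss : s' = s \/ s' = - s.
      have : s' ^+ 2 == s ^+ 2 by rewrite s2 s2'.
      by rewrite eqf_sqr => /orP[]/eqP; [left | right].
    have sE : s' / s' ^+ q = s / s ^+ q.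
      by case: ss => -> //; rewrite conjN invrN mulrNN.
    rewrite NE; move: E; rewrite sE => -[->|->]; [left|right]; exact: eqxx.
  by case=> /eqP->; rewrite card_closure_new // inH // ?c1 ?c2.
rewrite cards2 (inj_eq closure_line_inj) (inj_eq twisted_line_inj).
have s_n0 : s != 0 by rewrite -sqrf_eq0 s2.
rewrite -addr_eq0 -mulr2n -mulr_natl !mulf_eq0 (negPf two_neq0) (negPf s_n0) invr_eq0 /=.
by rewrite expf_eq0 (negPf s_n0) andbF.
Qed.

Lemma conjugate_hyperbola_dichotomy :
  ((forall P, P \in derset F q -> internal_pt K P) /\
     is_oval (hall_points F q) (hall_lines F q) (q ^ 2) (hall_set K)) \/
  ((forall P, P \in derset F q -> external_pt K P) /\
     #|[set L in hall_lines F q | #|L :&: hall_set K| == q.+1]| = 2%N).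
Proof.
have [sq|ns] := boolP (is_square e); [right | left]; split.
- by move=> P /card_derset_tangents[PK cP]; rewrite /external_pt PK cP sq.
- exact: two_secants_of_square.
- by move=> P /card_derset_tangents[PK cP]; rewrite /internal_pt PK cP (negPf ns).
exact: oval_of_nonsquare.
Qed.

End ConjugateHyperbola.
End QuadraticExtension.

Theorem theorem7p2 (F : finFieldType) (q p k : nat)
    (p_prime : prime p) (k_gt0 : (0 < k)%N) (q_pow : q = (p ^ k)%N)
    (q_odd : odd q) (q_gt3 : (3 < q)%N) (cardF : #|F| = (q ^ 2)%N)
    (K : {set pgpoint F}) (hypK : is_hyperbola K)
    (P1 P2 : pgpoint F) (K_inf : K :&: linf F = [set P1; P2])
    (P12_conj : conjugate_pts q P1 P2) :
  ((forall P, P \in derset F q -> internal_pt K P) /\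
     is_oval (hall_points F q) (hall_lines F q) (q ^ 2) (hall_set K)) \/
  ((forall P, P \in derset F q -> external_pt K P) /\
     #|[set L in hall_lines F q | #|L :&: hall_set K| == q.+1]| = 2%N).
Proof.
case: hypK => conicK _.
move: P12_conj; rewrite /conjugate_pts !in_setD => /and4P[/andP[nD1 _] /andP[nD2 _] + _].
case/existsP => x /existsP[y]; rewrite !is_ptE !row3_inf.
move=> /andP[/andP[nz /eqP P1E] /andP[_ /eqP P2E]].
rewrite P1E P2E in K_inf nD1 nD2.
have d0 := notin_derset q_odd nz nD1.
have K12 P : P \in [set pgpt x y 0; pgpt (x ^+ q) (y ^+ q) 0] -> P \in K.
  by rewrite -K_inf in_setI => /andP[].
have K1 := K12 _ (set21 _ _); have K2 := K12 _ (set22 _ _).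
(* A point of the derivation set shows that K misses a point at infinity. *)
have D1 : pgpt 1 0 0 \in derset F q.
  by apply/dersetP; exists 1, 0; rewrite GFq0 ?GFq1 ?xpair_eqE ?oner_eq0.
have [|s0 [t0 [e [e0 memK]]]] := hyperbola_equation conicK d0 K1 K2.
  have Dl : pgpt 1 0 0 \in linf F by rewrite linfE ?row3_inf ?xpair_eqE ?oner_eq0 ?eqxx.
  exists (pgpt 1 0 0) => //; apply/negP => hK.
  have : pgpt 1 0 0 \in K :&: linf F by rewrite in_setI hK.
  by rewrite K_inf in_set2 => /orP[]/eqP E; [move: nD1|move: nD2]; rewrite -E D1.
rewrite -subr_eq0 in d0.
exact: (conjugate_hyperbola_dichotomy p_prime k_gt0 q_pow q_odd cardF q_gt3
          d0 e0 memK K_inf nD1 nD2).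
Qed.
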